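(* Let $\mathcal K_0$ be one of the following five classes of neighborhood frames: the monotonic frames, the quasi-filter frames, the augmented quasi-filter frames, the filter frames, or the augmented filter frames. Let $\mathcal K$ be CPL-elementary relative to $\mathcal K_0$, i.e. there is a set $T$ of $L_=$-sentences with $\mathcal K=\{F\in\mathcal K_0 : F\models T\}$. Then the variety of BAMs generated by $\mathcal K^+=\{F^+: F\in\mathcal K\}$ is canonical, i.e. closed under canonical extensions.
   Context: A neighborhood frame is a pair $F=(F,N^F)$ with $N^F: F\to\mathscr P(\mathscr P(F))$. It is monotonic if each $N^F(w)$ is closed under supersets; quasi-filter if it is monotonic and each $N^F(w)$ is closed under intersections of nonempty finite families; filter if it is quasi-filter and each $N^F(w)$ is nonempty; augmented quasi-filter if each $N^F(w)$ is empty or a principal upset of $\mathscr P(F)$; augmented filter if each $N^F(w)$ is a principal upset. $L_=$ is the least set of formulas containing equality atoms and closed under Boolean combinations, existential quantification, and formation of $x\,\Box_y\,\phi$ ($y$ bound). Satisfaction in a neighborhood frame is as in first-order logic, with $F\models w\,\Box_y\,\phi(y)$ iff $\{v\in F: F\models\phi(v)\}\in N^F(w)$. A BAM is a Boolean algebra $A$ with a monotone map $\Box:A\to A$. For a monotonic frame $F$, $F^+=(\mathscr P(F),\Box^F)$ with $\Box^F(X)=\{w: X\in N^F(w)\}$. For a BAM $A$, let $\mathrm{Uf}(A)$ be its set of ultrafilters, $[a]=\{u\in\mathrm{Uf}(A): a\in u\}$; closed subsets of $\mathrm{Uf}(A)$ are intersections of sets $[a]$. The canonical extension is $A^\sigma=(\mathscr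 P(\mathrm{Uf}(A)),\Box^\sigma)$ with $\Box^\sigma(u)=\bigcup_{K\text{ closed},\,K\subseteq u}\ \bigcap_{a\in A,\,[a]\supseteq K}[\Box(a)]$ for $u\subseteq\mathrm{Uf}(A)$. A class of BAMs is canonical if it contains $A^\sigma$ whenever it contains $A$. *)

(* Defs.v *)
From Stdlib Require Import List.
Import ListNotations.

Record nframe := NFrame {
  pt : Type;
  nbh : pt -> (pt -> Prop) -> Prop
}.

Definition subset {T : Type} (X Y : T -> Prop) : Prop := forall x, X x -> Y x.

Definition monotonic (F : nframe) : Prop :=
  forall w X Y, nbh F w X -> subset X Y -> nbh F w Y.

Definition quasi_filter (F : nframe) : Prop :=
  monotonic F /\
  forall w (l : list (pt F -> Prop)), l <> [] -> Forall (nbh F w) l ->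
    nbh F w (fun x => Forall (fun X => X x) l).

Definition filter_frame (F : nframe) : Prop :=
  quasi_filter F /\ forall w, exists X, nbh F w X.

Definition principal_upset {T : Type} (S : (T -> Prop) -> Prop) : Prop :=
  exists X0 : T -> Prop, forall X, S X <-> subset X0 X.

Definition aug_quasi_filter (F : nframe) : Prop :=
  forall w, (forall X, ~ nbh F w X) \/ principal_upset (nbh F w).

Definition aug_filter (F : nframe) : Prop :=
  forall w, principal_upset (nbh F w).

Inductive base_class := Monotonic | QuasiFilter | AugQuasiFilter | Filter | AugFilter.

Definition in_base (K0 : base_class) (F : nframe) : Prop :=
  match K0 with
  | Monotonic => monotonic F
  | QuasiFilter => quasi_filter F
  | AugQuasiFilter => aug_quasi_filter F
  | Filter => filter_frame F
  | AugFilter => aug_filter F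
  end.

Inductive form :=
  | fEq  : nat -> nat -> form
  | fNeg : form -> form
  | fAnd : form -> form -> form
  | fOr  : form -> form -> form
  | fEx  : nat -> form -> form
  | fBox : nat -> nat -> form -> form.   (* fBox x y phi = x Box_y phi, y bound *)

Fixpoint free (z : nat) (phi : form) : Prop :=
  match phi with
  | fEq x y => z = x \/ z = y
  | fNeg p => free z p
  | fAnd p q | fOr p q => free z p \/ free z q
  | fEx x p => z <> x /\ free z p
  | fBox x y p => z = x \/ (z <> y /\ free z p)
  end.

Definition sentence (phi : form) : Prop := forall z, ~ free z phi.

Definition upd {T : Type} (g : nat -> T) (y : nat) (v : T) : nat -> T :=
  fun z => if Nat.eqb z y then v else g z.

Fixpoint sat (F : nframe) (g : nat -> pt F) (phi : form) : Prop :=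
  match phi with
  | fEq x y => g x = g y
  | fNeg p => ~ sat F g p
  | fAnd p q => sat F g p /\ sat F g q
  | fOr p q => sat F g p \/ sat F g q
  | fEx x p => exists v, sat F (upd g x v) p
  | fBox x y p => nbh F (g x) (fun v => sat F (upd g y v) p)
  end.

Definition models (F : nframe) (T : form -> Prop) : Prop :=
  forall phi, T phi -> forall g : nat -> pt F, sat F g phi.

Record BAMsig := BAMSig {
  car : Type;
  bmeet : car -> car -> car;
  bjoin : car -> car -> car;
  bcompl : car -> car;
  btop : car;
  bbot : car;
  bbox : car -> car
}.

Definition ble (A : BAMsig) (a b : car A) : Prop := bmeet A a b = a.

Definition isBAM (A : BAMsig) : Prop :=
  (forall a b, bmeet A a b = bmeet A b a) /\
  (forall a b, bjoin A a b = bjoin A b a) /\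
  (forall a b c, bmeet A a (bmeet A b c) = bmeet A (bmeet A a b) c) /\
  (forall a b c, bjoin A a (bjoin A b c) = bjoin A (bjoin A a b) c) /\
  (forall a b, bmeet A a (bjoin A a b) = a) /\
  (forall a b, bjoin A a (bmeet A a b) = a) /\
  (forall a b c, bmeet A a (bjoin A b c) = bjoin A (bmeet A a b) (bmeet A a c)) /\
  (forall a, bmeet A a (btop A) = a) /\
  (forall a, bjoin A a (bbot A) = a) /\
  (forall a, bmeet A a (bcompl A a) = bbot A) /\
  (forall a, bjoin A a (bcompl A a) = btop A) /\
  (forall a b, ble A a b -> ble A (bbox A a) (bbox A b)).

Definition cplx (F : nframe) : BAMsig :=
  {| car := pt F -> Prop;
     bmeet := fun X Y w => X w /\ Y w;
     bjoin := fun X Y w => X w \/ Y w;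
     bcompl := fun X w => ~ X w;
     btop := fun _ => True;
     bbot := fun _ => False;
     bbox := fun X w => nbh F w X |}.

Definition ultrafilter (A : BAMsig) (u : car A -> Prop) : Prop :=
  u (btop A) /\ ~ u (bbot A) /\
  (forall a b, u a -> ble A a b -> u b) /\
  (forall a b, u a -> u b -> u (bmeet A a b)) /\
  (forall a, u a \/ u (bcompl A a)).

Definition Uf (A : BAMsig) : Type := { u : car A -> Prop | ultrafilter A u }.

Definition hat (A : BAMsig) (a : car A) : Uf A -> Prop := fun u => proj1_sig u a.

Definition closed_set (A : BAMsig) (K : Uf A -> Prop) : Prop :=
  exists S : car A -> Prop, forall u, K u <-> (forall a, S a -> hat A a u).

Definition box_sigma (A : BAMsig) (U : Uf A -> Prop) : Uf A -> Prop :=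
  fun u => exists K, closed_set A K /\ subset K U /\
             forall a, subset K (hat A a) -> hat A (bbox A a) u.

Definition canext (A : BAMsig) : BAMsig :=
  {| car := Uf A -> Prop;
     bmeet := fun X Y w => X w /\ Y w;
     bjoin := fun X Y w => X w \/ Y w;
     bcompl := fun X w => ~ X w;
     btop := fun _ => True;
     bbot := fun _ => False;
     bbox := box_sigma A |}.

Inductive term :=
  | tVar : nat -> term
  | tMeet : term -> term -> term
  | tJoin : term -> term -> term
  | tCompl : term -> term
  | tTop : term
  | tBot : term
  | tBox : term -> term.

Fixpoint eval (A : BAMsig) (v : nat -> car A) (t : term) : car A :=
  match t with
  | tVar n => v n
  | tMeet s t => bmeet A (eval A v s) (eval A v t)
  | tJoin s t => bjoin A (eval A v s) (eval A v t)
  | tCompl s => bcompl A (eval A v s)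
  | tTop => btop A
  | tBot => bbot A
  | tBox s => bbox A (eval A v s)
  end.

Definition holds (A : BAMsig) (e : term * term) : Prop :=
  forall v : nat -> car A, eval A v (fst e) = eval A v (snd e).

(* Variety generated by a class C of BAMs, as the class of BAMs satisfying
   every equation valid in all members of C (= HSP(C) by Birkhoff). *)
Definition gen_variety (C : BAMsig -> Prop) (A : BAMsig) : Prop :=
  isBAM A /\ forall e, (forall B, C B -> holds B e) -> holds A e.

Definition canonical_class (V : BAMsig -> Prop) : Prop :=
  forall A, V A -> V (canext A).

Definition Kclass (K0 : base_class) (T : form -> Prop) (F : nframe) : Prop :=
  in_base K0 F /\ models F T.

Definition Kplus (K0 : base_class) (T : form -> Prop) (B : BAMsig) : Prop :=
  exists F, Kclass K0 T F /\ B = cplx F.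

(* Main.v *)
(* Let [A] belong to the variety and let [u] be an ultrafilter of [A]. Every
   finite set of terms over [A] whose values lie in [u] is satisfied at a point
   of some frame of [K]. A countable iteration of ultrapowers over an ultraproduct
   of these frames, with neighborhoods generated by closed (intersections of
   internal) sets, is a frame [L] of [K]: internal sets keep their neighborhood
   status, so the L_=-theory is preserved, and the base class is preserved by
   saturation. Also by saturation, for points [c] of [L] realizing an ultrafilter
   [u'] of [A], membership of [c] in the box of a set only depends on the trace of
   that set on such points, and is given by [box_sigma]. Hence valuations on the
   canonical extension transfer to [L] and an equation failing at [u] fails in [L]. *)
From Stdlib Require Import List Lia PeanoNat ssreflect.
From mathcomp Require boolp filter.
Require Import Defs.
Import ListNotations.

(** * Extensionality and fine ultrafilters *)

Lemma pred_ext {T : Type} (X Y : T -> Prop) : (forall x, X x <-> Y x) -> X = Y.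
Proof.
by move=> XY; apply boolp.functional_extensionality_dep => x; apply: boolp.propext.
Qed.

(** The cones of lists containing all members of some [l0] generate a proper filter [G], since
    concatenation of lists intersects cones; any ultrafilter above [G] is fine. *)
Lemma fine_ultrafilter_exists (J : Type) :
  exists D : (list J -> Prop) -> Prop,
    (forall X Y, D X -> D Y -> D (fun l => X l /\ Y l)) /\
    (forall X Y : list J -> Prop, (forall l, X l -> Y l) -> D X -> D Y) /\
    (forall X, ~ D X <-> D (fun l => ~ X l)) /\
    (forall j, D (In j)).
Proof.
set G : (list J -> Prop) -> Prop :=
  fun X => exists l0, forall l, (forall j, In j l0 -> In j l) -> X l.
have GP : filter.ProperFilter G.
  split; first by move=> [l0 /(_ l0)]; apply.
  split.
  - by exists [].
  - move=> X Y [l1 H1] [l2 H2]; exists (l1 ++ l2) => l Hl; split.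
      by apply: H1 => j Hj; apply: Hl; apply/in_or_app; left.
    by apply: H2 => j Hj; apply: Hl; apply/in_or_app; right.
  - by move=> X Y XY [l1 H1]; exists l1 => l Hl; apply/XY/H1.
have [D [DU GD]] := filter.ultraFilterLemma GP.
have DP := filter.ultra_proper (UltraFilter := DU).
have DF := filter.filter_filter (ProperFilter := DP).
exists D; split; first exact: filter.filterI.
split; first exact: filter.filterS.
split.
  move=> X; split=> [nX|DnX DX].
    by case: (filter.in_ultra_setVsetC X DU).
  apply: (filter.filter_not_empty D).
  apply: filter.filterS (filter.filterI DX DnX).
  by move=> l [].
by move=> j; apply: GD; exists [j] => l; apply; left.
Qed.

(** * Locality of satisfaction and the base classes *)

(** Only finitely many points of an assignment matter, so in the limit frame their supports have a
    common bound ([sat_supp]). *)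
Lemma sat_bounded (phi : form) :
  exists N, forall F (g g' : nat -> pt F),
    (forall z, z < N -> g z = g' z) -> sat F g phi <-> sat F g' phi.
Proof.
elim: phi => [x y|p [N IH]|p [N IHp] q [M IHq]|p [N IHp] q [M IHq]|x p [N IH]|x y p [N IH]].
- exists (S (Nat.max x y)) => F g g' E /=; rewrite !E //; lia.
- by exists N => F g g' E /=; rewrite (IH F g g').
- exists (Nat.max N M) => F g g' E /=.
  rewrite (IHp F g g'); last by move=> z ?; apply: E; lia.
  by rewrite (IHq F g g') // => z ?; apply: E; lia.
- exists (Nat.max N M) => F g g' E /=.
  rewrite (IHp F g g'); last by move=> z ?; apply: E; lia.
  by rewrite (IHq F g g') // => z ?; apply: E; lia.
- exists N => F g g' E /=.
  have H v : sat F (upd g x v) p <-> sat F (upd g' x v) p.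
    by apply: IH => z zN; rewrite /upd; case: Nat.eqb => //; apply: E.
  by split=> -[v /H Hv]; exists v.
- exists (S (Nat.max N x)) => F g g' E /=.
  rewrite (E x); last lia.
  have -> // : (fun v => sat F (upd g y v) p) = (fun v => sat F (upd g' y v) p).
  apply: pred_ext => v.
  by apply: IH => z zN; rewrite /upd; case: Nat.eqb => //; apply: E; lia.
Qed.

Lemma aug_quasi_filter_monotonic (F : nframe) : aug_quasi_filter F -> monotonic F.
Proof.
move=> HF w X Y HX XY; have [N|[X0 H0]] := HF w; first by have := N X.
by apply/H0 => x /(proj1 (H0 X) HX)/XY.
Qed.

Lemma aug_filter_aug_quasi_filter (F : nframe) : aug_filter F -> aug_quasi_filter F.
Proof. by move=> HF w; right; exact: HF. Qed.

Lemma in_base_monotonic (K0 : base_class) (F : nframe) : in_base K0 F -> monotonic F.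
Proof.
case: K0 => //=; [by case|exact: aug_quasi_filter_monotonic|by case=> [[]]|].
by move/aug_filter_aug_quasi_filter; exact: aug_quasi_filter_monotonic.
Qed.

Lemma quasi_filter_inter (F : nframe) w X Y :
  quasi_filter F -> nbh F w X -> nbh F w Y -> nbh F w (fun x => X x /\ Y x).
Proof.
move=> [F_mono HF] HX HY; apply: F_mono (HF w [X; Y] _ _) _ => //; first by auto.
by move=> x; rewrite !Forall_cons_iff => -[? []].
Qed.

Lemma quasi_filter_of_inter (F : nframe) :
  monotonic F ->
  (forall w X Y, nbh F w X -> nbh F w Y -> nbh F w (fun x => X x /\ Y x)) ->
  quasi_filter F.
Proof.
move=> F_mono HF; split=> // w; elim=> // X [|Y l] IH _ /Forall_cons_iff[HX Hl].
  by apply: F_mono HX _ => x; auto.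
by apply: F_mono (HF _ _ _ HX (IH _ Hl)) _ => // x [? ?]; constructor.
Qed.

(* Terms with variables from an arbitrary type: a canonical extension is not
   determined by countable subalgebras, so [A] must name all of its elements. *)
Inductive pterm (X : Type) :=
  | pVar : X -> pterm X
  | pMeet : pterm X -> pterm X -> pterm X
  | pJoin : pterm X -> pterm X -> pterm X
  | pCompl : pterm X -> pterm X
  | pTop : pterm X
  | pBot : pterm X
  | pBox : pterm X -> pterm X.

Arguments pVar {X}. Arguments pMeet {X}. Arguments pJoin {X}. Arguments pCompl {X}.
Arguments pTop {X}. Arguments pBot {X}. Arguments pBox {X}.

Fixpoint peval {X : Type} (A : BAMsig) (v : X -> car A) (t : pterm X) : car A :=
  match t with
  | pVar x => v x
  | pMeet s t => bmeet A (peval A v s) (peval A v t)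
  | pJoin s t => bjoin A (peval A v s) (peval A v t)
  | pCompl s => bcompl A (peval A v s)
  | pTop => btop A
  | pBot => bbot A
  | pBox s => bbox A (peval A v s)
  end.

Fixpoint rename {X : Type} (f : X -> nat) (t : pterm X) : term :=
  match t with
  | pVar x => tVar (f x)
  | pMeet s t => tMeet (rename f s) (rename f t)
  | pJoin s t => tJoin (rename f s) (rename f t)
  | pCompl s => tCompl (rename f s)
  | pTop => tTop
  | pBot => tBot
  | pBox s => tBox (rename f s)
  end.

Lemma eval_rename {X : Type} (A : BAMsig) (f : X -> nat) (v : nat -> car A) (t : pterm X) :
  eval A v (rename f t) = peval A (fun x => v (f x)) t.
Proof. by elim: t => //= [s -> t ->|s -> t ->|s ->|s ->]. Qed.

Lemma peval_finite {X : Type} (t : pterm X) :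
  exists l : list X, forall A (v v' : X -> car A),
    (forall x, In x l -> v x = v' x) -> peval A v t = peval A v' t.
Proof.
elim: t => [x|s [l Hl] t [m Hm]|s [l Hl] t [m Hm]|s [l Hl]|||s [l Hl]].
- by exists [x] => A v v' H /=; apply: H; left.
- exists (l ++ m) => A v v' H /=; rewrite (Hl A v v'); last by
    move=> x ?; apply: H; apply/in_or_app; left.
  by rewrite (Hm A v v') // => x ?; apply: H; apply/in_or_app; right.
- exists (l ++ m) => A v v' H /=; rewrite (Hl A v v'); last by
    move=> x ?; apply: H; apply/in_or_app; left.
  by rewrite (Hm A v v') // => x ?; apply: H; apply/in_or_app; right.
- by exists l => A v v' H /=; rewrite (Hl A v v').
- by exists [].
- by exists [].
- by exists l => A v v' H /=; rewrite (Hl A v v').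
Qed.

(** Terms over [A] must be renamed into [term] before an equation of the variety applies to them;
    [r] undoes the renaming on the variables in use. *)
Lemma list_naming {X : Type} (x0 : X) (l : list X) :
  exists (f : X -> nat) (r : nat -> X), forall x, In x l -> r (f x) = x.
Proof.
have H x : exists k, In x l -> nth k l x0 = x.
  case: (boolp.EM (In x l)) => [xl|nx]; last by exists 0.
  by have [k [_ Hk]] := In_nth l x x0 xl; exists k.
by have [f Hf] := boolp.choice H; exists f, (fun k => nth k l x0).
Qed.

(** * Boolean algebras and their ultrafilters *)

Section BooleanAlgebra.

Variable A : BAMsig.
Hypothesis HA : isBAM A.

Lemma meetC a b : bmeet A a b = bmeet A b a. Proof. exact: (proj1 HA). Qed.

Lemma joinC a b : bjoin A a b = bjoin A b a. Proof. exact: (proj1 (proj2 HA)). Qed.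

Lemma meet_idem a : bmeet A a a = a.
Proof.
case: HA => _ [_ [_ [_ [mj [_ [_ [_ [jb _]]]]]]]].
by rewrite -{2}(jb a) mj.
Qed.

Lemma ble_meetl a b : ble A (bmeet A a b) a.
Proof.
case: HA => mC [_ [mA _]].
by rewrite /ble mC mA meet_idem.
Qed.

Lemma ble_meetr a b : ble A (bmeet A a b) b.
Proof. by rewrite meetC; exact: ble_meetl. Qed.

Lemma join_compl_top a b : ble A a b -> bjoin A (bcompl A a) b = btop A.
Proof.
case: HA => _ [_ [_ [jA [_ [jm [_ [mt [_ [_ [jc _]]]]]]]]]] ab.
have jt x : bjoin A (btop A) x = btop A by rewrite -{2}(jm (btop A) x) meetC mt.
rewrite -(jm b a) (meetC b a) ab (joinC b a) jA (joinC _ a) jc; exact: jt.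
Qed.

Lemma join_compl_top_l a : bjoin A (bcompl A (btop A)) a = a.
Proof.
case: HA => _ [_ [_ [_ [_ [_ [_ [mt [jb [mc _]]]]]]]]].
by rewrite -(mt (bcompl A (btop A))) meetC mc joinC jb.
Qed.

Lemma Uf_up (u : Uf A) a b : hat A a u -> ble A a b -> hat A b u.
Proof. by case: u => u [? [? [H ?]]]; exact: H. Qed.

Lemma Uf_top (u : Uf A) : hat A (btop A) u.
Proof. by case: u => u []. Qed.

Lemma Uf_bot (u : Uf A) : ~ hat A (bbot A) u.
Proof. by case: u => u [? []]. Qed.

Lemma Uf_meet (u : Uf A) a b : hat A (bmeet A a b) u <-> hat A a u /\ hat A b u.
Proof.
split=> [H|[]]; last by case: u => u [? [? [? [H ?]]]]; exact: H.
by split; apply: Uf_up H _; [exact: ble_meetl|exact: ble_meetr].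
Qed.

Lemma Uf_compl (u : Uf A) a : hat A (bcompl A a) u <-> ~ hat A a u.
Proof.
split=> [H1 H2|].
  have /Uf_meet : hat A a u /\ hat A (bcompl A a) u by [].
  by case: HA => _ [_ [_ [_ [_ [_ [_ [_ [_ [-> _]]]]]]]]]; exact: Uf_bot.
by case: u => u [? [? [? [? H]]]]; case: (H a).
Qed.

Lemma Uf_eq (u u' : Uf A) : (forall a, hat A a u <-> hat A a u') -> u = u'.
Proof.
move=> /pred_ext; case: u u' => u Hu [u' Hu']; rewrite /hat /= => E.
have {}E : u = u' by exact: E.
by subst u'; congr exist; apply: boolp.Prop_irrelevance.
Qed.

Lemma canext_isBAM : isBAM (canext A).
Proof.
(* The eleven Boolean laws are pointwise tautologies; for monotonicity of [box_sigma] the same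
   closed set [K] serves. *)
do 11![split; first by
  move=> a *; apply: pred_ext => u /=; have := boolp.EM (a u); tauto].
move=> X Y XY; apply: pred_ext => u /=; split=> [[]//|[K [HK [KX H]]]].
split; exists K; split=> //; split=> // w /KX Xw.
have XYw : (X w /\ Y w) = X w := f_equal (fun Z => Z w) XY.
by move: Xw; rewrite -XYw => -[].
Qed.

End BooleanAlgebra.

(** * Iterated ultrafilter quantifiers *)

Section LimitQuantifier.

Variables (J : Type) (D : (list J -> Prop) -> Prop).
Hypothesis D_and : forall X Y, D X -> D Y -> D (fun l => X l /\ Y l).
Hypothesis D_mono : forall X Y : list J -> Prop, (forall l, X l -> Y l) -> D X -> D Y.
Hypothesis D_not : forall X, ~ D X <-> D (fun l => ~ X l).
Hypothesis D_fine : forall j, D (In j).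

Notation I := (list J).

(** Infinite sequences host all levels of the iteration at once: a member of level [n] is a function
    ignoring the coordinates from [n] on, that is, invariant under padding them with the empty
    list. *)
Definition trunc (n : nat) (r : nat -> I) : nat -> I :=
  fun k => if Nat.ltb k n then r k else [].

Definition supp {X : I -> Type} (n : nat) (s : forall i, (nat -> I) -> X i) : Prop :=
  forall i r, s i (trunc n r) = s i r.

Definition fin_supp {X : I -> Type} (s : forall i, (nat -> I) -> X i) : Prop :=
  exists n, supp n s.

Lemma trunc_trunc (n m : nat) (r : nat -> I) :
  n <= m -> trunc n (trunc m r) = trunc n r.
Proof.
move=> nm; apply boolp.functional_extensionality_dep => k; rewrite /trunc.
case: (Nat.ltb_spec k n) => // kn.
by case: (Nat.ltb_spec k m) => // ?; lia.
Qed.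

Lemma supp_le {X : I -> Type} (n m : nat) (s : forall i, (nat -> I) -> X i) :
  n <= m -> supp n s -> supp m s.
Proof. by move=> nm Hs i r; rewrite -(Hs i (trunc m r)) trunc_trunc // Hs. Qed.

Lemma trunc_upd (n : nat) (r : nat -> I) (l : I) : trunc n (upd r n l) = trunc n r.
Proof.
apply boolp.functional_extensionality_dep => k; rewrite /trunc /upd.
case: (Nat.ltb_spec k n) => // kn.
by case: (Nat.eqb_spec k n) => // ?; lia.
Qed.

Lemma supp_upd {X : I -> Type} (n : nat) (s : forall i, (nat -> I) -> X i) i r l :
  supp n s -> s i (upd r n l) = s i r.
Proof. by move=> Hs; rewrite -(Hs i (upd r n l)) trunc_upd Hs. Qed.

(* Coordinate [n] of [r] is the index of the [n]-th ultrapower taken over the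
   ultraproduct indexed by [i], so later coordinates are quantified outermost. *)
Fixpoint Q (n : nat) (X : I -> (nat -> I) -> Prop) : Prop :=
  match n with
  | 0 => D (fun i => X i (fun _ => []))
  | S n => D (fun l => Q n (fun i r => X i (upd r n l)))
  end.

Lemma Q_and n X Y : Q n X -> Q n Y -> Q n (fun i r => X i r /\ Y i r).
Proof.
elim: n X Y => [|n IH] X Y /= HX HY; first exact: D_and.
apply: D_mono (D_and _ _ HX HY) => l [QX QY].
exact: (IH (fun i r => X i (upd r n l)) (fun i r => Y i (upd r n l))).
Qed.

Lemma Q_mono n (X Y : I -> (nat -> I) -> Prop) :
  (forall i r, X i r -> Y i r) -> Q n X -> Q n Y.
Proof.
elim: n X Y => [|n IH] X Y XY /=; first by apply: D_mono => i; apply: XY.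
by apply: D_mono => l; apply: IH => i r; apply: XY.
Qed.

Lemma Q_not n X : ~ Q n X <-> Q n (fun i r => ~ X i r).
Proof.
elim: n X => [|n IH] X /=; first exact: D_not.
have -> : (fun l => Q n (fun i r => ~ X i (upd r n l))) =
          (fun l => ~ Q n (fun i r => X i (upd r n l))).
  apply: pred_ext => l.
  exact: (iff_sym (IH (fun i r => X i (upd r n l)))).
exact: D_not.
Qed.

Lemma D_const (P : Prop) : D (fun _ => P) <-> P.
Proof.
have H0 : ~ D (fun _ => False).
  by move=> H; apply: (proj2 (D_not (fun _ => False)) _ H); apply: D_mono H.
split=> [DP|p].
  by apply: boolp.contrapT => nP; apply: H0; apply: D_mono DP.
by apply: D_mono (proj1 (D_not (fun _ => False)) H0).
Qed.

Lemma Q_supp_S n X : supp n X -> (Q (S n) X <-> Q n X).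
Proof.
move=> HX /=.
have -> : (fun l => Q n (fun i r => X i (upd r n l))) = (fun _ : I => Q n X).
  apply boolp.functional_extensionality_dep => l; congr (Q n _).
  apply boolp.functional_extensionality_dep => i.
  by apply boolp.functional_extensionality_dep => r; apply: supp_upd.
exact: D_const.
Qed.

Lemma Q_supp n m X : supp n X -> n <= m -> (Q m X <-> Q n X).
Proof.
move=> HX; elim=> // {}m nm IH.
by rewrite Q_supp_S //; apply: supp_le HX.
Qed.

(** Truth in the union of the chain of ultrapowers. Under finite support the value of [Q] is stable
    from the support bound on ([W_Q]), which is what makes [W] commute with negation. *)
Definition W (X : I -> (nat -> I) -> Prop) : Prop :=
  exists n0, forall n, n0 <= n -> Q n X.

Lemma W_Q n X : supp n X -> (W X <-> Q n X).
Proof.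
move=> HX; split=> [[n0 H]|H].
  by apply/(Q_supp n (Nat.max n n0)) => //; [lia|apply: H; lia].
by exists n => m nm; apply/(Q_supp n m).
Qed.

Lemma W_and X Y : W X -> W Y -> W (fun i r => X i r /\ Y i r).
Proof.
move=> [n Hn] [m Hm]; exists (Nat.max n m) => k Hk.
by apply: Q_and; [apply: Hn|apply: Hm]; lia.
Qed.

Lemma W_mono (X Y : I -> (nat -> I) -> Prop) :
  (forall i r, X i r -> Y i r) -> W X -> W Y.
Proof. by move=> XY [n H]; exists n => m /H; apply: Q_mono. Qed.

Lemma W_true (X : I -> (nat -> I) -> Prop) : (forall i r, X i r) -> W X.
Proof.
move=> HX; apply: (W_mono (fun _ _ => True)) => [i r _|]; first exact: HX.
by apply/(W_Q 0) => //=; apply/D_const.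
Qed.

Lemma W_false (X : I -> (nat -> I) -> Prop) : (forall i r, ~ X i r) -> ~ W X.
Proof.
move=> HX [n /(_ n (le_n n)) H].
have /Q_not : Q n (fun i r => ~ X i r) by apply: Q_mono H => i r; move/HX.
exact.
Qed.

Lemma W_not X : fin_supp X -> (W (fun i r => ~ X i r) <-> ~ W X).
Proof.
move=> [n HX]; rewrite (W_Q n X) // (W_Q n (fun i r => ~ X i r)); last by move=> i r; rewrite HX.
by have [] := Q_not n X; split.
Qed.

(* The elements [e l] are glued along the fresh coordinate [n]. *)
Lemma W_glue {X : I -> Type} (n : nat) (P : J -> forall i, (nat -> I) -> X i -> Prop)
    (e : I -> forall i, (nat -> I) -> X i) :
  (forall j, supp n (P j)) -> (forall l, supp n (e l)) ->
  (forall l j, In j l -> W (fun i r => P j i r (e l i r))) ->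
  exists e0 : forall i, (nat -> I) -> X i,
    supp (S n) e0 /\ forall j, W (fun i r => P j i r (e0 i r)).
Proof.
move=> HP He H; exists (fun i r => e (r n) i r).
have Hn : supp (S n) (fun i r => e (r n) i r).
  move=> i r; rewrite {1}/trunc.
  have -> : Nat.ltb n (S n) = true by apply/Nat.ltb_lt; lia.
  exact: (supp_le n (S n) (e (r n)) (Nat.le_succ_diag_r n)).
split=> // j.
have HS : supp (S n) (fun i r => P j i r (e (r n) i r)).
  move=> i r; rewrite (Hn i r) (supp_le n (S n) (P j) _ _ i r) //; lia.
apply/(W_Q (S n)) => //=.
(* Coordinate [n] is quantified outermost, and by fineness almost all of its values [l] contain [j],
   where [e l] works. *)
apply: D_mono (D_fine j) => l jl.
have HPe : supp n (fun i r => P j i r (e l i r)).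
  by move=> i r; rewrite HP He.
have := H l j jl; rewrite (W_Q n) //.
apply: Q_mono => i r.
by rewrite (supp_upd n (P j)) // {1}/upd Nat.eqb_refl (supp_upd n (e l)).
Qed.

Lemma W_all (l : list J) (X : J -> I -> (nat -> I) -> Prop) :
  (forall j, In j l -> W (X j)) -> W (fun i r => forall j, In j l -> X j i r).
Proof.
elim: l => [|a l IH] H; first exact: W_true.
have Ha := H a (or_introl eq_refl).
have Hl := IH (fun j jl => H j (or_intror jl)).
apply: W_mono (W_and _ _ Ha Hl) => i r [Xa Xl] j /=.
by case=> [<-//|]; apply: Xl.
Qed.

Lemma fin_supp_pair {X Y : I -> Type} (s : forall i, (nat -> I) -> X i)
    (t : forall i, (nat -> I) -> Y i) :
  fin_supp s -> fin_supp t -> exists n, supp n s /\ supp n t.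
Proof.
move=> [n Hs] [m Ht]; exists (Nat.max n m).
by split; [apply: supp_le Hs|apply: supp_le Ht]; lia.
Qed.

(** * The limit ultraproduct of neighborhood frames *)

Section LimitFrame.

Variables (F : I -> nframe) (p0 : forall i, pt (F i)) (j0 : J).
Hypothesis F_mono : forall i, monotonic (F i).

Definition fam : Type := forall i, (nat -> I) -> pt (F i).
Definition iset : Type := forall i, (nat -> I) -> pt (F i) -> Prop.

Definition eqW (e e' : fam) : Prop := W (fun i r => e i r = e' i r).

(** Classes of [eqW] encoded as predicates, so that equality atoms are interpreted by Leibniz
    equality. *)
Definition lpt : Type :=
  { P : fam -> Prop | exists e, fin_supp e /\ P = eqW e }.

Definition repr (c : lpt) : fam :=
  proj1_sig (boolp.constructive_indefinite_description (proj2_sig c)).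

Lemma reprP (c : lpt) : fin_supp (repr c) /\ proj1_sig c = eqW (repr c).
Proof. by rewrite /repr; case: boolp.constructive_indefinite_description. Qed.

Definition repr_fin (c : lpt) : fin_supp (repr c) := proj1 (reprP c).

Lemma eqW_refl e : eqW e e. Proof. exact: W_true. Qed.

Lemma eqW_sym e e' : eqW e e' -> eqW e' e.
Proof. by apply: W_mono => i r ->. Qed.

Lemma eqW_trans e1 e2 e3 : eqW e1 e2 -> eqW e2 e3 -> eqW e1 e3.
Proof. by move=> H1 H2; apply: W_mono (W_and _ _ H1 H2) => i r [-> ->]. Qed.

Lemma repr_inj (c c' : lpt) : eqW (repr c) (repr c') -> c = c'.
Proof.
move=> H; have [_ E] := reprP c; have [_ E'] := reprP c'.
have {E E'}: proj1_sig c = proj1_sig c'.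
  rewrite E E'; apply: pred_ext => e; split; last exact: eqW_trans.
  by apply: eqW_trans; apply: eqW_sym.
case: c c' {H} => [P HP] [P' HP'] /= E; subst P'.
by congr exist; apply: boolp.Prop_irrelevance.
Qed.

Lemma repr_surj (e : fam) : fin_supp e -> exists c, eqW (repr c) e.
Proof.
move=> He.
pose c : lpt := exist _ (eqW e) (ex_intro _ e (conj He eq_refl)).
exists c; have [_ /= <-] := reprP c; exact: eqW_refl.
Qed.

(** An [S] of finite support represents an internal set, and [mem] is membership in it. *)
Definition mem (S : iset) (e : fam) : Prop := W (fun i r => S i r (e i r)).

Lemma mem_eqW S e e' : eqW e e' -> mem S e -> mem S e'.
Proof. by move=> H1 H2; apply: W_mono (W_and _ _ H1 H2) => i r [-> ]. Qed.

Lemma fin_supp_app (S : iset) (e : fam) :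
  fin_supp S -> fin_supp e -> fin_supp (X := fun _ => Prop) (fun i r => S i r (e i r)).
Proof.
move=> HS He; have [n [{}HS {}He]] := fin_supp_pair _ _ HS He.
by exists n => i r; rewrite HS He.
Qed.

Lemma mem_compl (S : iset) (c : lpt) :
  fin_supp S -> mem (fun i r x => ~ S i r x) (repr c) <-> ~ mem S (repr c).
Proof.
move=> HS; rewrite -(W_not (fun i r => S i r (repr c i r))) //.
exact: fin_supp_app HS (repr_fin c).
Qed.

Definition pick i (X : pt (F i) -> Prop) : pt (F i) :=
  match boolp.pselect (exists x, X x) with
  | left H => proj1_sig (boolp.constructive_indefinite_description H)
  | right _ => p0 i
  end.

Lemma pickP i (X : pt (F i) -> Prop) : (exists x, X x) -> X (pick i X).
Proof.
rewrite /pick; case: boolp.pselect => // H _.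
by case: boolp.constructive_indefinite_description.
Qed.

(** [pick] depends on the set [S i r] alone, so the chosen family inherits the support bound of
    [S]. *)
Lemma W_choose (S : iset) n :
  supp n S -> W (fun i r => exists x, S i r x) ->
  exists e : fam, supp n e /\ mem S e.
Proof.
move=> HS H; exists (fun i r => pick i (S i r)); split; first by move=> i r; rewrite HS.
by apply: W_mono H => i r; apply: pickP.
Qed.

(** Otherwise [W_choose] yields a point of [S] outside [T]. *)
Lemma mem_subset (S T : iset) :
  fin_supp S -> fin_supp T ->
  (forall c, mem S (repr c) -> mem T (repr c)) ->
  W (fun i r => subset (S i r) (T i r)).
Proof.
move=> fS fT ST; have [n [HS HT]] := fin_supp_pair _ _ fS fT.
apply: boolp.contrapT; rewrite -W_not; last by exists n => i r; rewrite HS HT.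
move=> H.
have [||e [He1 He2]] := W_choose (fun i r x => S i r x /\ ~ T i r x) n.
- by move=> i r; rewrite HS HT.
- apply: W_mono H => i r /boolp.existsNP[x /boolp.not_implyP xST].
  by exists x.
have [c Hc] := repr_surj e (ex_intro _ n He1).
have /(mem_eqW _ _ _ (eqW_sym _ _ Hc)) H2 := He2.
have /ST : mem S (repr c) by apply: W_mono H2 => i r [].
by apply/mem_compl => //; apply: W_mono H2 => i r [].
Qed.

(** Saturation. If every finite [l] fails, the counterexamples [e l] all have support [n], and
    [W_glue] merges them along the fresh coordinate [n] into a point of every [S j] outside [T]. *)
Lemma mem_compact n (S : J -> iset) (T : iset) :
  (forall j, supp n (S j)) -> supp n T ->
  (forall c, (forall j, mem (S j) (repr c)) -> mem T (repr c)) ->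
  exists l : list J, forall c, (forall j, In j l -> mem (S j) (repr c)) -> mem T (repr c).
Proof.
move=> HS HT ST; apply: boolp.contrapT => Hl.
have He l : exists e : fam, supp n e /\
    mem (fun i r x => (forall j, In j l -> S j i r x) /\ ~ T i r x) e.
  apply: W_choose.
    move=> i r; rewrite HT; apply: pred_ext => x.
    by split=> -[H ?]; split=> // j /H; rewrite HS.
  apply: boolp.contrapT => nW; apply: Hl; exists l => c Hc.
  apply: boolp.contrapT => /(mem_compl T c (ex_intro _ n HT)) nT; apply: nW.
  apply: W_mono (W_and _ _ (W_all l _ Hc) nT) => i r [H1 H2].
  by exists (repr c i r).
have [e {}He] := boolp.choice He.
have [||l j jl|e0 [He0 He0m]] :=
  W_glue n (fun j i r x => S j i r x /\ ~ T i r x) e.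
- by move=> j i r; rewrite HS HT.
- by move=> l; have [] := He l.
- have [_] := He l; apply: W_mono => i r [H ?]; split=> //; exact: H.
have [c Hc] := repr_surj e0 (ex_intro (fun n => supp n e0) _ He0).
have {}He0m j : mem (fun i r x => S j i r x /\ ~ T i r x) (repr c).
  by apply: mem_eqW (He0m j); apply: eqW_sym.
have /ST : forall j, mem (S j) (repr c).
  by move=> j; apply: W_mono (He0m j) => i r [].
(* Lying outside [T] was recorded alongside each [S j], so some index [j0] is needed to read it
   off. *)
by apply/mem_compl; [exists n|apply: W_mono (He0m j0) => i r []].
Qed.

(** * Neighborhoods in the limit and the theorem of Łoś *)

Definition inbh (c : lpt) (S : iset) : Prop :=
  W (fun i r => nbh (F i) (repr c i r) (S i r)).

Lemma inbh_mono c (S T : iset) :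
  fin_supp S -> fin_supp T ->
  (forall c', mem S (repr c') -> mem T (repr c')) -> inbh c S -> inbh c T.
Proof.
move=> fS fT ST HS.
apply: W_mono (W_and _ _ HS (mem_subset _ _ fS fT ST)) => i r [] ; exact: F_mono.
Qed.

Definition inter (S : J -> iset) (c : lpt) : Prop := forall j, mem (S j) (repr c).

(* [X] is a neighborhood of [c] when it contains an intersection of internal
   sets all of whose internal supersets are internal neighborhoods of [c].
   Internal families are indexed by [J] and of bounded support, which is what
   the saturation [mem_compact] of the limit ultraproduct covers. *)
Definition lnbh (c : lpt) (X : lpt -> Prop) : Prop :=
  exists n (S : J -> iset), (forall j, supp n (S j)) /\ subset (inter S) X /\
    forall T, fin_supp T -> subset (inter S) (fun c' => mem T (repr c')) -> inbh c T.

Definition lframe : nframe := NFrame lpt lnbh.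

Lemma lframe_monotonic : monotonic lframe.
Proof.
move=> c X Y [n [S [HS [SX H]]]] XY; exists n, S; split=> //; split=> //.
by move=> c' /SX/XY.
Qed.

(** From left to right, [S] is itself an internal superset of the witnessing intersection.
    Conversely the constant family [S] is a witness, its intersection being [S] because [j0]
    inhabits [J]. *)
Lemma lnbh_internal c (S : iset) :
  fin_supp S -> lnbh c (fun c' => mem S (repr c')) <-> inbh c S.
Proof.
move=> fS; split=> [[n [S' [HS' [SS' H]]]]|HS]; first exact: H.
have [n Hn] := fS; exists n, (fun _ => S); split=> //; split=> [c' /(_ j0)//|T fT ST].
by apply: inbh_mono HS => // c' Hc'; apply: ST.
Qed.

Definition fams_at (g : nat -> lpt) i r : nat -> pt (F i) := fun z => repr (g z) i r.

Lemma fams_at_upd g y c i r :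
  fams_at (upd g y c) i r = upd (fams_at g i r) y (repr c i r).
Proof.
apply boolp.functional_extensionality_dep => z; rewrite /fams_at /upd.
by case: Nat.eqb.
Qed.

Lemma fams_at_supp (g : nat -> lpt) N :
  exists n, forall z, z < N -> supp n (repr (g z)).
Proof.
elim: N => [|N [n IH]]; first by exists 0 => z; lia.
have [m Hm] := repr_fin (g N); exists (Nat.max n m) => z zN.
have [->|zN'] : z = N \/ z < N by lia.
  by apply: supp_le Hm; lia.
by apply: supp_le (IH z zN'); lia.
Qed.

Lemma sat_supp (g : nat -> lpt) phi :
  fin_supp (X := fun _ => Prop) (fun i r => sat (F i) (fams_at g i r) phi).
Proof.
have [N HN] := sat_bounded phi; have [n Hn] := fams_at_supp g N.
exists n => i r; apply: boolp.propext; apply: HN => z zN; exact: Hn.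
Qed.

Lemma sat_upd_supp (g : nat -> lpt) y phi :
  fin_supp (X := fun i => pt (F i) -> Prop)
    (fun i r v => sat (F i) (upd (fams_at g i r) y v) phi).
Proof.
have [N HN] := sat_bounded phi; have [n Hn] := fams_at_supp g N.
exists n => i r; apply: pred_ext => v; apply: HN => z zN.
by rewrite /upd; case: Nat.eqb => //; exact: Hn.
Qed.

(** The theorem of Łoś. Quantifiers use [W_choose]; in the box case the truth set is internal by
    induction, so [lnbh_internal] applies. *)
Lemma lframe_sat (phi : form) (g : nat -> lpt) :
  sat lframe g phi <-> W (fun i r => sat (F i) (fams_at g i r) phi).
Proof.
elim: phi g => [x y|p IH|p IHp q IHq|p IHp q IHq|x p IH|x y p IH] g /=.
- split=> [E|]; first by apply: W_true => i r; rewrite /fams_at E.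
  exact: repr_inj.
- by rewrite IH W_not //; apply: sat_supp.
- rewrite IHp IHq; split=> [[Hp Hq]|H]; first exact: W_and.
  by split; apply: W_mono H => i r [].
- rewrite IHp IHq; split=> [[]|H].
  + by apply: W_mono => i r; left.
  + by apply: W_mono => i r; right.
  case: (boolp.EM (W (fun i r => sat (F i) (fams_at g i r) p))) => [|nW]; first by left.
  right; have {}nW := proj2 (W_not _ (sat_supp g p)) nW.
  by apply: W_mono (W_and _ _ H nW) => i r [[]].
- split=> [[c /IH]|H].
    apply: W_mono => i r Hc; exists (repr c i r); by rewrite -fams_at_upd.
  have [n Hn] := sat_upd_supp g x p.
  have [e [He1 He2]] := W_choose _ n Hn H.
  have [c Hc] := repr_surj e (ex_intro _ n He1).
  exists c; apply/IH.
  have := mem_eqW _ _ _ (eqW_sym _ _ Hc) He2.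
  by apply: W_mono => i r; rewrite fams_at_upd.
- apply: iff_trans _ (lnbh_internal (g x) _ (sat_upd_supp g y p)).
  have -> // : (fun v => sat lframe (upd g y v) p) =
     (fun c => mem (fun i r v => sat (F i) (upd (fams_at g i r) y v) p) (repr c)).
  apply: pred_ext => c; rewrite IH /mem.
  by split; apply: W_mono => i r; rewrite fams_at_upd.
Qed.

Lemma lframe_models (T : form -> Prop) : (forall i, models (F i) T) -> models lframe T.
Proof. by move=> FT phi Tphi g; apply/lframe_sat/W_true => i r; exact: FT. Qed.

(** * Preservation of the base classes *)

(** The witness is the family of intersections [S1 j] with [S2 j]. By saturation an internal
    superset [T] contains a finite part of it, which splits into internal supersets [T1], [T2] of
    the two given intersections; these are intersected in the components. *)
Lemma lnbh_inter c X Y :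
  (forall i, quasi_filter (F i)) ->
  lnbh c X -> lnbh c Y -> lnbh c (fun c' => X c' /\ Y c').
Proof.
move=> F_qf [n1 [S1 [HS1 [SX H1]]]] [n2 [S2 [HS2 [SY H2]]]].
pose n := Nat.max n1 n2.
have {}HS1 j : supp n (S1 j) by apply: supp_le (HS1 j); lia.
have {}HS2 j : supp n (S2 j) by apply: supp_le (HS2 j); lia.
pose S j : iset := fun i r x => S1 j i r x /\ S2 j i r x.
have HS j : supp n (S j) by move=> i r; rewrite /S HS1 HS2.
have S_S1 c' : inter S c' -> inter S1 c'.
  by move=> H j; apply: W_mono (H j) => i r [].
have S_S2 c' : inter S c' -> inter S2 c'.
  by move=> H j; apply: W_mono (H j) => i r [].
exists n, S; split=> //; split=> [c' Hc'|T [m HT] ST].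
  by split; [apply/SX/S_S1|apply/SY/S_S2].
have [||//|l Hl] := mem_compact (Nat.max n m) S T.
- by move=> j; apply: supp_le (HS j); lia.
- by apply: supp_le HT; lia.
pose T1 : iset := fun i r x => forall j, In j l -> S1 j i r x.
pose T2 : iset := fun i r x => forall j, In j l -> S2 j i r x.
have HT1 : supp n T1.
  by move=> i r; apply: pred_ext => x; split=> H j jl; have := H j jl; rewrite HS1.
have HT2 : supp n T2.
  by move=> i r; apply: pred_ext => x; split=> H j jl; have := H j jl; rewrite HS2.
have HT12 : supp n (fun i r x => T1 i r x /\ T2 i r x).
  by move=> i r; rewrite HT1 HT2.
apply: (inbh_mono c _ T (ex_intro _ n HT12) (ex_intro _ m HT)).
  move=> c' Hc'; apply: Hl => j jl.
  by apply: W_mono Hc' => i r [H1' H2']; split; [apply: H1'|apply: H2'].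
have I1 : inbh c T1.
  apply: H1; first by exists n.
  by move=> c' Hc'; apply: W_all => j _; exact: Hc'.
have I2 : inbh c T2.
  apply: H2; first by exists n.
  by move=> c' Hc'; apply: W_all => j _; exact: Hc'.
by apply: W_mono (W_and _ _ I1 I2) => i r []; exact: quasi_filter_inter.
Qed.

(** By monotonicity it is enough to test the full set, which is internal. *)
Lemma lnbh_nonempty c :
  (exists X, lnbh c X) <-> W (fun i r => exists X, nbh (F i) (repr c i r) X).
Proof.
have fT : @fin_supp (fun i => pt (F i) -> Prop) (fun _ _ _ => True) by exists 0.
split=> [[X [n [S [_ [_ H]]]]]|H].
  apply: W_mono (H _ fT _) => [i r HX|c' _]; first by exists (fun _ => True).
  exact: W_true.
exists (fun c' => mem (fun _ _ _ => True) (repr c')); apply/lnbh_internal => //.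
by apply: W_mono H => i r [X HX]; apply: F_mono HX _.
Qed.

(* The generator is the internal set of the generators of the components. *)
Lemma lnbh_principal c :
  (forall i, aug_quasi_filter (F i)) -> (exists X, lnbh c X) -> principal_upset (lnbh c).
Proof.
move=> F_aug /lnbh_nonempty Hc.
pose Z : iset := fun i r x => forall X, nbh (F i) (repr c i r) X -> X x.
have fZ : fin_supp Z.
  by have [n Hn] := repr_fin c; exists n => i r; rewrite /Z Hn.
have HZ : lnbh c (fun c' => mem Z (repr c')).
  apply/lnbh_internal => //; apply: W_mono Hc => i r [X HX].
  have [N|[X0 H0]] := F_aug i (repr c i r); first by have := N X.
  by apply/H0 => x X0x Y /H0; apply.
exists (fun c' => mem Z (repr c')) => X; split=> [[n [S [HS [SX H]]]] c' Hc'|ZX].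
  (* Each [S j] is an internal neighborhood, so it contains [Z] componentwise. *)
  apply: SX => j.
  have HSj : inbh c (S j).
    by apply: H; [exists n; exact: HS|move=> c'' /(_ j)].
  by apply: W_mono (W_and _ _ HSj Hc') => i r [HSr]; apply.
exact: (lframe_monotonic c _ X HZ ZX).
Qed.

Lemma lframe_in_base (K0 : base_class) :
  (forall i, in_base K0 (F i)) -> in_base K0 lframe.
Proof.
have qf : (forall i, quasi_filter (F i)) -> quasi_filter lframe.
  move=> H; apply: quasi_filter_of_inter; first exact: lframe_monotonic.
  by move=> w X Y; apply: lnbh_inter.
case: K0 => /= [_|//|H w|H|H w]; first exact: lframe_monotonic.
- case: (boolp.EM (exists X, lnbh w X)) => [/(lnbh_principal w H)|nX]; first by right.
  by left=> X HX; apply: nX; exists X.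
- split; first by apply: qf => i; exact: (proj1 (H i)).
  by move=> w; apply/lnbh_nonempty/W_true => i r; exact: (proj2 (H i)).
- apply: lnbh_principal; first by move=> i; exact/aug_filter_aug_quasi_filter.
  apply/lnbh_nonempty/W_true => i r.
  by have [X0 H0] := H i (repr w i r); exists X0; apply/H0.
Qed.

(** * Transfer to the canonical extension *)

Section Transfer.

Variables (A : BAMsig) (tm : J -> pterm (car A)).
Hypothesis HA : isBAM A.
Hypothesis tm_surj : forall t, exists j, tm j = t.
Variable V : forall i, car A -> pt (F i) -> Prop.

Definition val (t : pterm (car A)) : car A := peval A (fun a => a) t.

Definition truth_set (t : pterm (car A)) : iset := fun i _ => peval (cplx (F i)) (V i) t.

Definition tru (c : lpt) (t : pterm (car A)) : Prop := mem (truth_set t) (repr c).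

(** The point [c] realizes [u] as a complete type. Ranging over all terms, not just variables, lets
    [over] speak about boxes. *)
Definition over (c : lpt) (u : Uf A) : Prop := forall t, tru c t <-> hat A (val t) u.

Lemma truth_set_fin t : fin_supp (truth_set t). Proof. by exists 0. Qed.

Lemma tru_meet c s t : tru c (pMeet s t) <-> tru c s /\ tru c t.
Proof.
split=> [H|[Hs Ht]]; first by split; apply: W_mono H => i r [].
exact: W_and.
Qed.

Lemma tru_compl c t : tru c (pCompl t) <-> ~ tru c t.
Proof. exact: mem_compl (truth_set_fin t). Qed.

Lemma tru_join c s t : tru c (pJoin s t) <-> tru c s \/ tru c t.
Proof.
split=> [H|[]]; last first.
- by apply: W_mono => i r; right.
- by apply: W_mono => i r; left.
case: (boolp.EM (tru c s)) => [|/tru_compl ns]; first by left.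
by right; apply: W_mono (W_and _ _ H ns) => i r [[]].
Qed.

Lemma tru_top c : tru c pTop. Proof. exact: W_true. Qed.

Lemma tru_bot c : ~ tru c pBot. Proof. by apply: W_false => i r. Qed.

(** If [val s] is below [val t], the implication from [s] to [t] is a term of value [btop], hence
    true at [c]; so the elements true at [c] form an ultrafilter. *)
Lemma over_exists c : (forall t, val t = btop A -> tru c t) -> exists u, over c u.
Proof.
move=> Hc.
have imp s t : ble A (val s) (val t) -> tru c s -> tru c t.
  move=> st Hs; have /tru_join[/tru_compl//|//] : tru c (pJoin (pCompl s) t).
  by apply: Hc; exact: join_compl_top.
have refl a : ble A a a by exact: meet_idem.
have Hu : ultrafilter A (fun a => tru c (pVar a)).
  split; first by apply: Hc.
  split; first by move=> Hb; apply: (tru_bot c); apply: imp Hb; exact: refl.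
  split; first by move=> a b Ha ab; apply: imp Ha.
  split.
    move=> a b Ha Hb; apply: (imp (pMeet (pVar a) (pVar b))); first exact: refl.
    exact/tru_meet.
  move=> a; case: (boolp.EM (tru c (pVar a))) => [|/tru_compl na]; first by left.
  by right; apply: imp na.
by exists (exist _ _ Hu) => t; split; apply: imp.
Qed.

Lemma over_inj c u u' : over c u -> over c u' -> u = u'.
Proof. by move=> H H'; apply: Uf_eq => a; rewrite -(H (pVar a)) -(H' (pVar a)). Qed.

Lemma filter_term (P : car A -> Prop) (l : list J) :
  P (btop A) -> (forall a b, P a -> P b -> P (bmeet A a b)) ->
  exists t, P (val t) /\
    forall c, tru c t <-> forall j, In j l -> P (val (tm j)) -> tru c (tm j).
Proof.
move=> P1 PM; elim: l => [|j l [t [Pt Ht]]].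
  by exists pTop; split=> // c; split=> // _; exact: tru_top.
case: (boolp.EM (P (val (tm j)))) => Pj.
  exists (pMeet (tm j) t); split; first exact: PM.
  move=> c; rewrite tru_meet Ht; split=> [[Hj Hl] k /= [<-//|kl]|H]; first exact: Hl.
  by split; [apply: H => //; left|move=> k kl; apply: H; right].
exists t; split=> // c; rewrite Ht; split=> H k; last by move=> kl; apply: H; right.
by move=> /= [<-//|kl]; apply: H.
Qed.

(** Saturation with the terms valued in a filter [P] as extra conditions; the finitely many that get
    used are merged into one term. Below, [P] is the filter of a closed set, an ultrafilter, or the
    top element alone. *)
Lemma filter_compact (P : car A -> Prop) n (S : J -> iset) (T : iset) :
  P (btop A) -> (forall a b, P a -> P b -> P (bmeet A a b)) ->
  (forall j, supp n (S j)) -> supp n T ->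
  (forall c, inter S c -> (forall t, P (val t) -> tru c t) -> mem T (repr c)) ->
  exists t, P (val t) /\ forall c, inter S c -> tru c t -> mem T (repr c).
Proof.
move=> P1 PM HS HT H.
pose S' j : iset := fun i r x => S j i r x /\ (P (val (tm j)) -> truth_set (tm j) i r x).
have S'E c j : mem (S' j) (repr c) <->
    mem (S j) (repr c) /\ (P (val (tm j)) -> tru c (tm j)).
  split=> [H'|[H1 H2]].
    split; first by apply: W_mono H' => i r [].
    by move=> Pj; apply: W_mono H' => i r [_]; apply.
  case: (boolp.EM (P (val (tm j)))) => Pj.
    by apply: W_mono (W_and _ _ H1 (H2 Pj)) => i r [].
  by apply: W_mono H1.
have [|//||l Hl] := mem_compact n S' T.
- by move=> j i r; rewrite /S' HS.
- move=> c Hc; apply: H => [j|t Pt]; first by have /S'E[] := Hc j.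
  by have [j jt] := tm_surj t; subst t; have /S'E[_] := Hc j; apply.
have [t [Pt Ht]] := filter_term P l P1 PM.
by exists t; split=> // c Sc /Ht Hc; apply: Hl => j jl; apply/S'E; split; auto.
Qed.

(** The witness intersects the truth sets of all terms valued in the filter [P] of [K]. An internal
    superset [T] already contains one such truth set, of [t] say, and [pBox t] holds at [w] because
    the box of [val t] lies in [u]. *)
Lemma box_sigma_lnbh (U : Uf A -> Prop) (E : lpt -> Prop) w u :
  (forall c u', over c u' -> (E c <-> U u')) -> over w u ->
  box_sigma A U u -> lnbh w E.
Proof.
move=> EU wu [K [[B KB] [KU HK]]].
pose P a := subset K (hat A a).
have P1 : P (btop A) by move=> u' _; exact: Uf_top.
have PM a b : P a -> P b -> P (bmeet A a b).
  by move=> Pa Pb u' Ku'; apply/Uf_meet => //; split; [apply: Pa|apply: Pb].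
pose S j : iset := fun i r x => P (val (tm j)) -> truth_set (tm j) i r x.
have S_tru c : inter S c -> forall t, P (val t) -> tru c t.
  move=> Sc t Pt; have [j jt] := tm_surj t; subst t.
  by apply: W_mono (Sc j) => i r; apply.
exists 0, S; split=> //; split=> [c Sc|T [n HT] ST].
  (* Since [btop] is in [P], points of [inter S] satisfy every term of value [btop]. *)
  have [u' cu'] : exists u', over c u'.
    by apply: over_exists => t t1; apply: S_tru => //; rewrite t1.
  apply/(EU c u' cu')/KU/KB => a Ba.
  apply/(cu' (pVar a))/(S_tru c Sc) => u'' /KB; exact.
have [|t [Pt Ht]] := filter_compact P n (fun _ _ _ _ => True) T P1 PM (fun _ _ _ => eq_refl) HT.
  move=> c _ Hc; apply: ST => j.
  case: (boolp.EM (P (val (tm j)))) => Pj; last by apply: W_true => i r /Pj.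
  by apply: W_mono (Hc _ Pj) => i r Hr _.
apply: (inbh_mono w _ T (truth_set_fin t) (ex_intro _ n HT)).
  by move=> c; apply: Ht => j; exact: W_true.
exact/(wu (pBox t))/HK.
Qed.

(** The closed set [K] collects the ultrafilters realized in [inter S]; saturation shows both that
    [K] is closed and that its clopen supersets come from internal supersets of [inter S]. *)
Lemma lnbh_box_sigma (U : Uf A -> Prop) (E : lpt -> Prop) w u :
  (forall c u', over c u' -> (E c <-> U u')) -> over w u ->
  lnbh w E -> box_sigma A U u.
Proof.
move=> EU wu [n [S [HS [SE H]]]].
pose K u' := exists c, inter S c /\ over c u'.
exists K; split; last split.
(* If [u'] is not realized in [inter S], some [t] with value in [u'] fails throughout [inter S];
   then the complement of [val t] contains [K], hence lies in [u']. *)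
- exists (fun a => subset K (hat A a)) => u'; split=> [Ku' a Ka|Hu']; first exact: Ka.
  apply: boolp.contrapT => nK.
  have [||//|//|c Sc Hc|t [Ht1 Ht2]] :=
    filter_compact (fun a => hat A a u') n S (fun _ _ _ => False).
  + exact: Uf_top.
  + by move=> a b ? ?; apply/Uf_meet.
  + case: nK; exists c; split=> // t; split=> [ct|]; last exact: Hc.
    apply: boolp.contrapT => /(Uf_compl A HA) nt.
    by have /tru_compl := Hc (pCompl t) nt; apply.
  have nt : hat A (bcompl A (val t)) u'.
    apply: Hu' => u'' [c [Sc cu'']]; apply/(Uf_compl A HA) => /cu'' ct.
    exact: (W_false (fun _ _ => False) (fun _ _ => id) (Ht2 c Sc ct)).
  by move/(Uf_compl A HA): nt; apply.
- by move=> u' [c [Sc cu']]; apply/(EU c u' cu')/SE.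
move=> a Ka.
have [//||//|//|c Sc Hc|t [Ht1 Ht2]] :=
  filter_compact (fun b => b = btop A) n S (truth_set (pVar a)).
- by move=> b c -> ->; exact: meet_idem.
- have [u' cu'] := over_exists c Hc.
  by apply/(cu' (pVar a))/Ka; exists c.
(* Points of [inter S] may violate [t], so the internal superset is the implication from [t] to [a],
   whose value is still [a]. *)
have /(wu (pBox (pJoin (pCompl t) (pVar a)))) : inbh w (truth_set (pJoin (pCompl t) (pVar a))).
  apply: H; first exact: truth_set_fin.
  move=> c Sc; apply/tru_join; case: (boolp.EM (tru c t)) => ct; last by left; apply/tru_compl.
  by right; exact: Ht2.
by rewrite /val /= -/(val t) Ht1 join_compl_top_l.
Qed.

(** The box lemmas ask for agreement only at points over ultrafilters, which is what the induction
    hypothesis gives. *)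
Lemma eval_over (v : nat -> Uf A -> Prop) (s : term) c u :
  over c u ->
  eval (cplx lframe) (fun n c => exists u, v n u /\ over c u) s c <->
  eval (canext A) v s u.
Proof.
elim: s c u => [n|s IHs t IHt|s IHs t IHt|s IH|||s IH] c u cu //=.
- split=> [[u' [vu' cu']]|vu]; last by exists u.
  by rewrite (over_inj c u u').
- by rewrite (IHs c u) // (IHt c u).
- by rewrite (IHs c u) // (IHt c u).
- by rewrite (IH c u).
- by split; [apply: lnbh_box_sigma|apply: box_sigma_lnbh].
Qed.

(** The class of the constant family [p0] realizes [u]: by fineness each term valued in [u] holds at
    almost all components. *)
Lemma over_surj (u : Uf A) :
  (forall l j, In j l -> hat A (val (tm j)) u -> peval (cplx (F l)) (V l) (tm j) (p0 l)) ->
  exists c, over c u.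
Proof.
move=> H; have Hp0 : supp 0 (fun i (_ : nat -> I) => p0 i) by [].
have [c Hc] := repr_surj _ (ex_intro (fun n => supp n _) 0 Hp0).
have Hu t : hat A (val t) u -> tru c t.
  have [j <-] := tm_surj t => Hj; apply: mem_eqW (eqW_sym _ _ Hc) _.
  by apply/(W_Q 0) => //; apply: D_mono (D_fine j) => l jl; apply: H.
exists c => t; split=> [ct|]; last exact: Hu.
apply: boolp.contrapT => /(Uf_compl A HA) nt.
by have /tru_compl := Hu (pCompl t) nt; apply.
Qed.

End Transfer.

End LimitFrame.

End LimitQuantifier.

(** * Finite satisfiability and conclusion *)

(** Let [t] be the meet of the listed terms valued in [u]. Were [t] unsatisfiable over the class,
    the equation of [t] with bottom would hold in [A], putting [bbot A] in [u]. *)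
Lemma finite_sat (K0 : base_class) (T : form -> Prop) (A : BAMsig) (u : Uf A)
    (l : list (pterm (car A))) :
  gen_variety (Kplus K0 T) A ->
  exists F, Kclass K0 T F /\ exists (V : car A -> pt F -> Prop) (w : pt F),
    forall t, In t l -> hat A (val A t) u -> peval (cplx F) V t w.
Proof.
move=> [HA Heq].
have [t [ut Ht]] : exists t, hat A (val A t) u /\ forall F (V : car A -> pt F -> Prop) w,
    peval (cplx F) V t w ->
    forall s, In s l -> hat A (val A s) u -> peval (cplx F) V s w.
  elim: l => [|s l [t [ut Ht]]]; first by exists pTop; split=> //; exact: Uf_top.
  case: (boolp.EM (hat A (val A s) u)) => us.
    exists (pMeet s t); split; first exact/(Uf_meet A HA).
    by move=> F V w [Hs /Ht Hl] s' /= [<-//|]; apply: Hl.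
  by exists t; split=> // F V w /Ht Hl s' /= [<-//|]; apply: Hl.
apply: boolp.contrapT => nF.
have [xs Hxs] := peval_finite t.
have [f [r Hfr]] := list_naming (btop A) xs.
have /Heq /(_ r) /= : forall B, Kplus K0 T B -> holds B (rename f t, tBot).
  move=> B [F [KF ->]] v; rewrite /= eval_rename; apply: pred_ext => w; split=> // Hw.
  case: nF; exists F; split=> //; exists (fun a => v (f a)), w; exact: Ht.
rewrite eval_rename (Hxs A _ (fun a => a)) // => t0.
by move: ut; rewrite /val t0; exact: Uf_bot.
Qed.

Theorem theorem5p4 (K0 : base_class) (T : form -> Prop)
  (HT : forall phi, T phi -> sentence phi) :
  canonical_class (gen_variety (Kplus K0 T)).
Proof.
move=> A VA; have HA := proj1 VA.
split=> [|[s t] Hst v]; first exact: canext_isBAM.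
apply: pred_ext => u /=.
pose J := pterm (car A).
have [D [D_and [D_mono [D_not D_fine]]]] := fine_ultrafilter_exists J.
(* The index set of the ultraproduct is the set of finite lists of terms; each list selects a frame,
   a valuation and a point satisfying its terms valued in [u]. *)
have Hl (l : list J) :
    exists M : {F : nframe & ((car A -> pt F -> Prop) * pt F)%type},
      Kclass K0 T (projT1 M) /\
      forall t, In t l -> hat A (val A t) u ->
        peval (cplx (projT1 M)) (fst (projT2 M)) t (snd (projT2 M)).
  have [F [KF [V [w H]]]] := finite_sat K0 T A u l VA.
  by exists (existT _ F (V, w)).
have [M HM] := boolp.choice Hl.
pose F l := projT1 (M l).
pose V l := fst (projT2 (M l)).
pose p l := snd (projT2 (M l)).
have F_mono l : monotonic (F l) := in_base_monotonic K0 _ (proj1 (proj1 (HM l))).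
have tm_surj : forall t : J, exists j : J, j = t by move=> j; exists j.
pose L := lframe J D F.
have KL : Kclass K0 T L.
  split.
    apply: (lframe_in_base J D D_and D_mono D_not D_fine F p pTop F_mono) => l.
    exact: (proj1 (proj1 (HM l))).
  apply: (lframe_models J D D_and D_mono D_not F p pTop F_mono) => l.
  exact: (proj2 (proj1 (HM l))).
have [c cu] : exists c, over J D F A V c u.
  apply: (over_surj J D D_and D_mono D_not D_fine F p A (fun t => t) HA tm_surj V u) => l.
  exact: (proj2 (HM l)).
have eval_c r :=
  eval_over J D D_and D_mono D_not D_fine F p pTop F_mono A _ HA tm_surj V v r c u cu.
rewrite -!eval_c.
have Lst : holds (cplx L) (s, t) by apply: Hst; exists L.
by rewrite (Lst _ : eval _ _ s = eval _ _ t).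
Qed.
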